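(* For all integers $J\ge 0$ and $N\ge 0$, $$MO(1,3J+2;3N+1)\equiv 0\pmod 9.$$
   Context: For an integer $a$ and a nonnegative integer $t$, define $MO(a,t;n)$ by the formal power series identity $$\sum_{n\ge 0}MO(a,t;n)\,q^n=\sum_{1\le n_1<n_2<\cdots<n_t}\frac{q^{n_1+n_2+\cdots+n_t}}{\prod_{k=1}^t(1+aq^{n_k}+q^{2n_k})},$$ where each factor $1/(1+aq^{m}+q^{2m})$ is expanded as a power series in $q$ with integer coefficients. *)

(* Defs.v *)
From HB Require Import structures.
From mathcomp Require Import all_boot all_order all_algebra.
From mathcomp Require Import boolp classical_sets functions cardinality fsbigop.

Set Implicit Arguments.
Unset Strict Implicit.
Unset Printing Implicit Defensive.

Import GRing.Theory.
Local Open Scope classical_set_scope.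
Local Open Scope ring_scope.

(* Formal power series in q with integer coefficients: f n is the coefficient
   of q^n. *)
Definition fps := nat -> int.

Definition fps_one : fps := fun n => (n == 0%N)%:R.

Definition fps_Xn (m : nat) : fps := fun n => (n == m)%:R.

Definition fps_mul (f g : fps) : fps :=
  fun n => \sum_(i < n.+1) f i * g (n - i)%N.

(* The first n coefficients of 1 / f for f with constant term 1, from the
   recurrence (1/f)_k = - \sum_(i < k) f_(k-i) (1/f)_i for k > 0. *)
Fixpoint fps_inv_seq (f : fps) (n : nat) : seq int :=
  if n is k.+1 then
    let s := fps_inv_seq f k in
    rcons s (if k == 0%N then 1 else - \sum_(i < k) f (k - i)%N * s`_i)
  else [::].

Definition fps_inv (f : fps) : fps := fun n => (fps_inv_seq f n.+1)`_n.

Lemma size_fps_inv_seq f n : size (fps_inv_seq f n) = n.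
Proof. by elim: n => //= n IHn; rewrite size_rcons IHn. Qed.

Lemma nth_fps_inv_seq f n i : (i < n)%N -> (fps_inv_seq f n)`_i = fps_inv f i.
Proof.
elim: n => // n IHn; rewrite ltnS leq_eqVlt => /predU1P[-> //|ltin].
by rewrite [fps_inv_seq _ _]/= nth_rcons size_fps_inv_seq ltin IHn.
Qed.

Lemma fps_invE f n : fps_inv f n =
  if n == 0%N then 1 else - \sum_(i < n) f (n - i)%N * fps_inv f i.
Proof.
rewrite {1}/fps_inv [fps_inv_seq _ _]/= nth_rcons size_fps_inv_seq ltnn eqxx.
by case: (n == 0%N) => //; congr (- _); apply: eq_bigr => i _;
  rewrite nth_fps_inv_seq.
Qed.

Lemma fps_mulV (f : fps) : f 0%N = 1 -> fps_mul f (fps_inv f) = fps_one.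
Proof.
move=> f0; apply/funext => n; rewrite /fps_mul /fps_one (reindex_inj rev_ord_inj).
rewrite (eq_bigr (fun i : 'I_n.+1 => f (n - i)%N * fps_inv f i)); last first.
  by move=> i _; rewrite /= subSS subKn // -ltnS.
rewrite big_ord_recr /= subnn f0 mul1r [X in _ + X]fps_invE.
by case: n => [|n]; rewrite ?big_ord0 ?add0r // subrr.
Qed.

(* 1 + a q^m + q^(2m) *)
Definition MO_den (a : int) (m : nat) : fps :=
  fun n => fps_one n + a * fps_Xn m n + fps_Xn (2 * m)%N n.

Lemma MO_den0 a m : (0 < m)%N -> MO_den a m 0%N = 1.
Proof. by case: m => // m _; rewrite /MO_den /fps_one /fps_Xn /= mulr0 !addr0. Qed.

(* q^(n_1 + ... + n_t) / \prod_k (1 + a q^(n_k) + q^(2 n_k)) for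
   s = [:: n_1; ...; n_t] *)
Definition MO_term (a : int) (s : seq nat) : fps :=
  fps_mul (fps_Xn (sumn s)) (\big[fps_mul/fps_one]_(m <- s) fps_inv (MO_den a m)).

(* [path ltn 0 s] says that 0 < n_1 < n_2 < ... < n_t. *)
Definition MO_index (t : nat) : set (t.-tuple nat) :=
  [set s : t.-tuple nat | path ltn 0%N s].
Arguments MO_index t : clear implicits.

(* The sum over all of MO_index is infinite; it is taken coefficientwise, and
   \sum_(s \in _) is the sum over the support, which is 0 by convention if the
   support is infinite. MO_finite below rules that case out. *)
Definition MO (a : int) (t n : nat) : int :=
  \sum_(s \in MO_index t) MO_term a s n.

Lemma MO_term_small a s n : (n < sumn s)%N -> MO_term a s n = 0.
Proof.
move=> lt_n; rewrite /MO_term /fps_mul big1 // => i _; rewrite /fps_Xn.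
case: eqP => [eq_i|_]; last by rewrite mul0r.
by have := ltn_ord i; rewrite eq_i ltnS leqNgt lt_n.
Qed.

Lemma MO_finite a t n :
  finite_set (MO_index t `&` [set s : t.-tuple nat | MO_term a s n != 0]).
Proof.
pose h (u : t.-tuple 'I_n.+1) : t.-tuple nat := [tuple of map val u].
apply: (@sub_finite_set _ _ (h @` setT)); last exact/finite_image/finite_finset.
move=> s [_ /= nz]; exists [tuple of map (@inord n) s] => //.
apply/val_inj; rewrite /= -map_comp map_id_in // => m ms /=.
apply: inordK; rewrite ltnS.
have: (sumn s <= n)%N by rewrite leqNgt; apply: contra nz => /MO_term_small->.
apply: leq_trans; elim: (tval s) ms => //= k r IHr; rewrite inE.
by case/predU1P => [->|/IHr le_m]; [exact: leq_addr | exact/(leq_trans le_m)/leq_addl].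
Qed.

(* Main.v *)
Require Import Defs.
From mathcomp Require Import all_boot all_order all_algebra.
From mathcomp Require Import ring zify.
From mathcomp Require Import boolp classical_sets functions cardinality fsbigop.

(* With x marking t, the generating function of MO(1,t;n) is
     prod_m (1 + (1+x) q^m + q^(2m)) / (1 + q^m + q^(2m)).
   Multiplying numerator and denominator by prod_m (1 - q^m) turns the
   denominator into prod_m (1 - q^(3m)) and, by the Jacobi triple product with
   1 + x = w + 1/w, the numerator into sum_k p_k(x) q^(k(k+1)/2), where
   p_k = w^k - w^(k-1) + ... + w^(-k). Only the k congruent to 1 mod 3
   contribute to the exponents 3N+1 of q, and
   p_(3m+1)(x) = x p_m(x^3 + 3x^2 - 3). Modulo 9, Taylor expansion gives
   p_m(x^3 - 3) + 3x^2 p_m'(x^3 - 3) for the second factor, so p_(3m+1) has no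
   monomial x^(3J+2) modulo 9.
   The triple product is obtained, modulo any given power of q, from its finite
   form with q-binomial coefficients. *)

Set Implicit Arguments.
Unset Strict Implicit.
Unset Printing Implicit Defensive.

Import GRing.Theory.
Local Open Scope ring_scope.

(** * Theta polynomials and their coefficients modulo 9 *)

(* For [1 + x = w + 1/w] this is
   [(w^(k+1/2) + w^(-k-1/2)) / (w^(1/2) + w^(-1/2))]
     [= w^k - w^(k-1) + ... + w^-k]. *)
Fixpoint theta_poly k : {poly int} :=
  match k with
  | 0 => 1
  | 1 => 'X
  | (k'.+1 as k1).+1 => (1 + 'X) * theta_poly k1 - theta_poly k'
  end.

Lemma theta_polySS k :
  theta_poly k.+2 = (1 + 'X) * theta_poly k.+1 - theta_poly k.
Proof. by []. Qed.

(* The substitution [w |-> w^3] maps [x] to [x^3 + 3 x^2 - 3]. *)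
Lemma theta_poly_triple m :
  theta_poly (3 * m).+1 = 'X * (theta_poly m \Po ('X^3 + 3%:P * 'X^2 - 3%:P)).
Proof.
(* With [y = x^3 + 3x^2 - 3], [w^3 + w^-3 = (1+x)^3 - 3(1+x) = 1 + y]: three steps of the recurrence
   at [x] act as one step at [y]. *)
have step k : theta_poly (k + 6) =
      ('X^3 + 3%:P * 'X^2 - 3%:P + 1) * theta_poly (k + 3) - theta_poly k.
  by rewrite !addnS addn0 !theta_polySS; ring.
elim/ltn_ind: m => -[_|[_|m IH]].
- by rewrite muln0 /= comp_polyC mulr1.
- by rewrite muln1 /= comp_polyX; ring.
have -> : (3 * m.+2).+1 = ((3 * m).+1 + 6)%N by rewrite !mulnS; ring.
rewrite step theta_polySS.
have -> : ((3 * m).+1 + 3)%N = (3 * m.+1).+1 by rewrite !mulnS; ring.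
rewrite !IH // comp_polyB comp_polyM comp_polyD comp_polyX comp_polyC.
ring.
Qed.

Lemma dvd9_coef_comp_cubic (f : {poly int}) J :
  (9 %| (f \Po ('X^3 + 3%:P * 'X^2 - 3%:P))`_(3 * J).+1)%Z.
Proof.
set y := (_ - _).
(* Taylor expansion of f at 'X^3 - 3, modulo 9 *)
have [u [v [r ->]]] : exists u v r : {poly int}, f \Po y =
    (u \Po 'X^3) + 3%:P * 'X^2 * (v \Po 'X^3) + 9%:P * r.
  elim/poly_ind: f => [|f c [u [v [r IH]]]].
    by exists 0, 0, 0; rewrite !comp_poly0; ring.
  (* These come from multiplying the expansion of [f] by [y = ('X^3 - 3) + 3 'X^2]; the square of
     [3 'X^2] goes into the multiple of 9. *)
  exists (('X - 3%:P) * u + c%:P), (('X - 3%:P) * v + u),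
    ('X^4 * (v \Po 'X^3) + y * r).
  rewrite comp_polyD comp_polyM IH !comp_polyD !comp_polyM comp_polyB.
  rewrite !comp_polyX !comp_polyC /y -[9]/(3 * 3 : int) polyCM; ring.
rewrite !coefD !coefCM -mulrA coefCM coefXnM !coef_comp_poly_Xn //.
have -> : (3 %| (3 * J).+1)%N = false.
  by rewrite -[(_ * _).+1]addn1 dvdn_addr ?dvdn_mulr.
have -> : (if ((3 * J).+1 < 2)%N then 0 else
    if (3 %| (3 * J).+1 - 2)%N then v`_(((3 * J).+1 - 2) %/ 3) else 0)
      = 0 :> int.
  case: J => [|J]; first by rewrite muln0.
  have -> : ((3 * J.+1).+1 - 2 = 2 + 3 * J)%N by rewrite mulnS; lia.
  by rewrite dvdn_addl ?dvdn_mulr //=; case: ifP.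
by rewrite mulr0 !add0r dvdz_mulr.
Qed.

(** * The finite triple product *)

Definition qpoch (R : comNzRingType) (q : R) n := \prod_(i < n) (1 - q ^+ i.+1).

(* This is [q ^+ (k * (k + 1) / 2)] times the q-binomial coefficient
   (2M+1 choose M-k), which is invariant under [k |-> -1 - k]: hence the index
   [k.-1], which is [0] at [k = 0]. *)
Fixpoint theta_coef (R : comNzRingType) (q : R) M k : R :=
  if M is M'.+1 then
    (1 + q ^+ (2 * M)) * theta_coef q M' k
      + q ^+ M * (theta_coef q M' k.-1 + theta_coef q M' k.+1)
  else (k == 0%N)%:R.

Lemma qpochS (R : comNzRingType) (q : R) n :
  qpoch q n.+1 = qpoch q n * (1 - q ^+ n.+1).
Proof. exact: big_ord_recr. Qed.

Lemma theta_coef_small (R : comNzRingType) (q : R) M k :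
  (M < k)%N -> theta_coef q M k = 0.
Proof.
elim: M k => [|M IH] [|k] //= ltMk.
by rewrite !IH ?(mulr0, addr0) //; lia.
Qed.

(** The product formula for q-binomial coefficients, cross-multiplied so as to make sense in any
    commutative ring. *)
Lemma theta_coefE (R : comNzRingType) (q : R) M k : (k <= M)%N ->
  qpoch q (M - k) * qpoch q (M + k).+1 * theta_coef q M k
    = q ^+ 'C(k.+1, 2) * qpoch q (2 * M).+1.
Proof.
elim: M k => [|M IH] k lekM.
  move: lekM; rewrite leqn0 => /eqP->.
  by rewrite subnn /qpoch big_ord0 !mul1r mulr1.
set d := (M.+1 - k)%N; set Q := qpoch q (2 * M).+1.
(* [low], [mid] and [high] express the three terms of the recurrence through [Q]. At [k = 0] the
   reflected index fits because ['C(0, 2) = 'C(1, 2)]. *)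
have low : qpoch q d * qpoch q (M + k).+2 * theta_coef q M k.-1
    = (1 - q ^+ (M + k).+1) * (1 - q ^+ (M + k).+2) * (q ^+ 'C(k, 2) * Q).
  rewrite {}/d; case: k lekM => [|k] lekM /=.
    move: (IH 0%N (leq0n _)); rewrite subn0 addn0 -/Q => IH0.
    by rewrite subn0 -[q ^+ _ * Q]IH0 !qpochS; ring.
  by rewrite -(IH k) // addnS subSS !qpochS; ring.
have mid : qpoch q d * qpoch q (M + k).+1 * theta_coef q M k
    = (1 - q ^+ d) * (q ^+ 'C(k.+1, 2) * Q).
  case: (leqP k M) => [lekM'|ltMk]; last first.
    by rewrite theta_coef_small // (_ : d = 0%N) ?expr0; [ring | lia].
  by rewrite -IH // (_ : d = (M - k).+1) ?qpochS; [ring | lia].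
have high : qpoch q d * qpoch q (M + k).+2 * theta_coef q M k.+1
    = (1 - q ^+ d) * (1 - q ^+ d.-1) * (q ^+ 'C(k.+2, 2) * Q).
  case: (leqP k.+1 M) => [lekM'|ltMk]; last first.
    rewrite theta_coef_small //.
    have [->|->] : d = 0%N \/ d = 1%N by lia.
      by rewrite expr0; ring.
    by rewrite expr0; ring.
  rewrite -IH // (_ : d = (M - k.+1).+2) ?addnS; last by lia.
  by rewrite !qpochS /=; ring.
(* This removes the truncated [d.-1]; at [d = 0] both sides vanish. *)
have shift : (1 - q ^+ d) * (1 - q ^+ d.-1) * q = (1 - q ^+ d) * (q - q ^+ d).
  by case: (d) => [|e] /=; rewrite ?expr0 ?exprS; ring.
have eM : M.+1 = (d + k)%N by lia.
rewrite addSn.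
transitivity ((1 + q ^+ (2 * M.+1)) * (1 - q ^+ (M + k).+2) *
      (qpoch q d * qpoch q (M + k).+1 * theta_coef q M k) +
    q ^+ M.+1 * (qpoch q d * qpoch q (M + k).+2 * theta_coef q M k.-1 +
      qpoch q d * qpoch q (M + k).+2 * theta_coef q M k.+1)).
  by rewrite /= -/d [qpoch q (M + k).+2]qpochS; ring.
rewrite mid low high (_ : (2 * M.+1).+1 = (2 * M).+3); last by lia.
rewrite 2!qpochS -/Q !binS !bin1 bin0.
rewrite (_ : (M + k).+2 = (d + k + k + 1)%N); last by lia.
rewrite (_ : (M + k).+1 = (d + k + k)%N); last by lia.
rewrite (_ : (2 * M).+3 = (d + d + k + k + 1)%N); last by lia.
rewrite (_ : (2 * M).+2 = (d + d + k + k)%N); last by lia.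
rewrite eM (_ : (2 * (d + k) = d + d + k + k)%N); last by lia.
rewrite !exprD !expr1; apply/eqP; rewrite -subr_eq0; apply/eqP.
transitivity (q ^+ d * q ^+ k * q ^+ k * q ^+ k * q ^+ 'C(k, 2) * Q *
  ((1 - q ^+ d) * (1 - q ^+ d.-1) * q - (1 - q ^+ d) * (q - q ^+ d))).
  by ring.
by rewrite shift subrr mulr0.
Qed.

(** Induction on [M]: [c * p k = p k.-1 + p k.+1], also at [k = 0] since [p 0 + p 1 = c]. Reindexing
    moves this shift onto the coefficients, which gives the recurrence of [theta_coef]. *)
Lemma finite_triple_product (R : comNzRingType) (q c : R) (p : nat -> R) M :
    p 0%N = 1 -> p 1%N = c - 1 -> (forall k, p k.+2 = c * p k.+1 - p k) ->
  \prod_(i < M) (1 + c * q ^+ i.+1 + q ^+ (2 * i.+1))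
    = \sum_(k < M.+1) theta_coef q M k * p k.
Proof.
move=> p0 p1 pSS; elim: M => [|M IH].
  by rewrite big_ord0 big_ord1 p0 mulr1.
rewrite big_ord_recr /= IH.
set a := theta_coef q M.
have aM k : (M < k)%N -> a k = 0 by apply: theta_coef_small.
have -> : \sum_(k < M.+2) ((1 + q ^+ (2 * M.+1)) * a k
      + q ^+ M.+1 * (a k.-1 + a k.+1)) * p k
    = (1 + q ^+ (2 * M.+1)) * (\sum_(k < M.+2) a k * p k)
      + q ^+ M.+1 * (\sum_(k < M.+2) a k.-1 * p k
                     + \sum_(k < M.+2) a k.+1 * p k).
  rewrite -big_split /= !mulr_sumr -big_split /=.
  by apply: eq_bigr => k _; ring.
have -> : \sum_(k < M.+2) a k.-1 * p k + \sum_(k < M.+2) a k.+1 * p k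
    = c * \sum_(k < M.+1) a k * p k.
  have -> : \sum_(k < M.+2) a k.-1 * p k
      = a 0%N * p 0%N + (a 0%N * p 1%N + \sum_(k < M) a k.+1 * p k.+2).
    by rewrite 2!big_ord_recl.
  have -> : \sum_(k < M.+2) a k.+1 * p k = \sum_(k < M) a k.+1 * p k.
    by rewrite 2!big_ord_recr /= !aM ?mul0r ?addr0.
  have -> : \sum_(k < M) a k.+1 * p k.+2
      = c * (\sum_(k < M) a k.+1 * p k.+1) - \sum_(k < M) a k.+1 * p k.
    by rewrite mulr_sumr -sumrB; apply: eq_bigr => k _; rewrite pSS; ring.
  by rewrite big_ord_recl /= p0 p1; ring.
by rewrite [X in _ = _ * X + _]big_ord_recr /= aM // mul0r addr0; ring.
Qed.

(** * Congruence modulo ['X^n] and truncation of power series *)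

Definition eqX (R : nzRingType) n (p q : {poly R}) :=
  forall i, (i < n)%N -> p`_i = q`_i.

Lemma eqX_sym (R : nzRingType) n (p q : {poly R}) : eqX n p q -> eqX n q p.
Proof. by move=> e i /e. Qed.

Lemma eqX_trans (R : nzRingType) n (q p r : {poly R}) :
  eqX n p q -> eqX n q r -> eqX n p r.
Proof. by move=> e f i ltin; rewrite e ?f. Qed.

Lemma eqXW (R : nzRingType) m n (p q : {poly R}) :
  (m <= n)%N -> eqX n p q -> eqX m p q.
Proof. by move=> lemn e i ltim; apply/e/(leq_trans ltim). Qed.

Lemma eqXD (R : nzRingType) n (p p' q q' : {poly R}) :
  eqX n p p' -> eqX n q q' -> eqX n (p + q) (p' + q').
Proof. by move=> ep eq i ltin; rewrite !coefD ep ?eq. Qed.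

Lemma eqXM (R : nzRingType) n (p p' q q' : {poly R}) :
  eqX n p p' -> eqX n q q' -> eqX n (p * q) (p' * q').
Proof.
move=> ep eq i ltin; rewrite !coefM; apply: eq_bigr => -[j /= ltji] _.
by rewrite ep ?eq //; lia.
Qed.

Lemma eqX_sum (R : nzRingType) n I (r : seq I) (P : pred I)
    (F G : I -> {poly R}) :
    (forall i, P i -> eqX n (F i) (G i)) ->
  eqX n (\sum_(i <- r | P i) F i) (\sum_(i <- r | P i) G i).
Proof. by move=> FG; apply: big_ind2 => //; apply: eqXD. Qed.

Lemma eqX_prod (R : nzRingType) n I (r : seq I) (P : pred I)
    (F G : I -> {poly R}) :
    (forall i, P i -> eqX n (F i) (G i)) ->
  eqX n (\prod_(i <- r | P i) F i) (\prod_(i <- r | P i) G i).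
Proof. by move=> FG; apply: big_ind2 => //; apply: eqXM. Qed.

Lemma eqX_map (R S : nzRingType) (f : {rmorphism R -> S}) n (p q : {poly R}) :
  eqX n p q -> eqX n (map_poly f p) (map_poly f q).
Proof. by move=> e i ltin; rewrite !coef_map e. Qed.

Definition trunc n (f : fps) : {poly int} := \poly_(i < n) f i.

Lemma eqX_trunc n f (p : {poly int}) :
  (forall i, (i < n)%N -> f i = p`_i) -> eqX n (trunc n f) p.
Proof. by move=> e i ltin; rewrite coef_poly ltin e. Qed.

Lemma trunc_mul n f g : eqX n (trunc n (fps_mul f g)) (trunc n f * trunc n g).
Proof.
apply: eqX_trunc => i ltin; rewrite coefM; apply: eq_bigr => -[j /= ltji] _.
by rewrite !coef_poly !ifT //; lia.
Qed.

Lemma trunc_Xn n m : eqX n (trunc n (fps_Xn m)) 'X^m.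
Proof. by apply: eqX_trunc => i _; rewrite coefXn. Qed.

Lemma trunc_prod n (s : seq nat) (F : nat -> fps) :
  eqX n (trunc n (\big[fps_mul/fps_one]_(m <- s) F m))
        (\prod_(m <- s) trunc n (F m)).
Proof.
elim: s => [|m s IH]; last first.
  by rewrite !big_cons; apply: eqX_trans (trunc_mul _ _) _; apply: eqXM.
by rewrite !big_nil; apply: (@trunc_Xn n 0).
Qed.

Lemma trunc_inv_MO_den n a m : (0 < m)%N ->
  eqX n ((1 + a%:P * 'X^m + 'X^(2 * m)) * trunc n (fps_inv (MO_den a m))) 1.
Proof.
move=> m_gt0.
apply: (@eqX_trans _ _ (trunc n (MO_den a m) * trunc n (fps_inv (MO_den a m)))).
  apply: eqXM => //; apply/eqX_sym/eqX_trunc => i _.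
  by rewrite !coefD coefCM !coefXn coef1.
apply: eqX_trans (eqX_sym (trunc_mul _ _)) _.
by rewrite fps_mulV ?MO_den0 //; apply: (@trunc_Xn n 0).
Qed.

(** * [MO] as a coefficient of a finite product *)

Definition MO_factor a n m := 'X^m * trunc n.+1 (fps_inv (MO_den a m)).

Lemma MO_termE a n s : MO_term a s n = (\prod_(m <- s) MO_factor a n m)`_n.
Proof.
transitivity (trunc n.+1 (MO_term a s))`_n; first by rewrite coef_poly ltnSn.
rewrite big_split /= -[\prod_(m <- s) 'X^m](_ : 'X^(sumn s) = _); last first.
  by rewrite sumnE (big_morph _ (exprD _) (expr0 _)).
apply: (eqX_trans (trunc_mul _ _) _ (ltnSn n)).
by apply: eqXM; [apply: trunc_Xn | apply: trunc_prod].
Qed.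

Lemma sorted_succ_enum n (J : {set 'I_n}) :
  sorted ltn [seq (val i).+1 | i <- enum J].
Proof.
rewrite (map_comp S val) (homo_sorted (e := ltn)) //.
apply: (subseq_sorted ltn_trans _ (iota_ltn_sorted 0 n)).
rewrite -val_enum_ord; apply: map_subseq.
by rewrite enumT; apply: filter_subseq.
Qed.

(** A part larger than [n] pushes the sum of the parts beyond [n], so only sets of parts from [1] to
    [n] contribute to the coefficient of [q^n]. *)
Lemma MO_sum_set a t n : MO a t n =
  \sum_(J : {set 'I_n} | #|J| == t) (\prod_(i in J) MO_factor a n i.+1)`_n.
Proof.
(* The zero tuple is a default value for [J] of cardinality other than [t]. *)
pose h (J : {set 'I_n}) : t.-tuple nat :=
  insubd (nseq_tuple t 0%N) [seq (val i).+1 | i <- enum J].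
have hE (J : {set 'I_n}) : #|J| == t ->
    h J = [seq (val i).+1 | i <- enum J] :> seq nat.
  by move=> cardJ; rewrite /h insubdK // -topredE /= size_map -cardE.
have memh (J : {set 'I_n}) i : #|J| == t ->
    (i.+1 \in tval (h J)) = (i \in [seq val j | j <- enum J]).
  by move=> /hE ->; rewrite (map_comp S val) mem_map // => ? ? [].
rewrite bigfs ?index_enum_uniq //; last first.
  by move=> J _; rewrite mem_index_enum.
transitivity (\sum_(J \in [set` [pred J : {set 'I_n} | #|J| == t]])
    MO_term a (h J) n); last first.
  apply: eq_fsbigr => J; rewrite inE /= => cardJ.
  by rewrite MO_termE hE // big_map big_enum.
rewrite /MO -(@fsbig_image _ _ _ _ _ _ h
  (fun s : t.-tuple nat => MO_term a s n)); last first.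
  move=> J K; rewrite !inE /= => cardJ cardK eq_h.
  apply/setP => i; rewrite -[i \in J]mem_enum -[i \in K]mem_enum.
  by rewrite -(mem_map val_inj) -[RHS](mem_map val_inj) -!memh // eq_h.
apply/esym/fsbig_widen.
  move=> _ [J /= cardJ <-]; rewrite /MO_index /= hE //.
  by rewrite path_min_sorted ?sorted_succ_enum //;
    apply/allP => _ /mapP[i _ ->].
move=> s [/= path_s notB]; apply: MO_term_small.
rewrite ltnNge; apply/negP => le_sum; apply: notB.
have le_s m : m \in tval s -> (m <= n)%N.
  move=> sm; apply: leq_trans le_sum.
  by rewrite sumnE (big_rem m) //= leq_addr.
have gt0_s m : m \in tval s -> (0 < m)%N.
  by apply/allP; apply: order_path_min path_s; apply: ltn_trans.
pose J := [set i : 'I_n | i.+1 \in tval s]%SET.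
have eJ : [seq (val i).+1 | i <- enum J] = s.
  apply: (irr_sorted_eq ltn_trans ltnn);
    rewrite ?sorted_succ_enum ?(path_sorted path_s) //.
  move=> m; apply/mapP/idP => [[i] | sm].
    by rewrite mem_enum inE => si ->.
  have ltmn : (m.-1 < n)%N by have := le_s _ sm; have := gt0_s _ sm; lia.
  by exists (Ordinal ltmn); rewrite ?mem_enum ?inE /= prednK ?gt0_s.
have cardJ : #|J| == t.
  by rewrite cardE -(size_map (fun i => (val i).+1)) eJ size_tuple.
by exists J => //; apply/val_inj; rewrite /= hE.
Qed.

(** The outer variable is [q], the inner one [x]. Expanding the product over subsets, each chosen
    part brings one factor [x]. *)
Lemma MO_generating_poly a t n : MO a t n =
  (\prod_(i < n) (1 + 'X%:P * map_poly polyC (MO_factor a n i.+1)))`_n`_t.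
Proof.
under eq_bigr do rewrite addrC.
rewrite bigA_distr !coef_sum MO_sum_set big_mkcond /=.
apply: eq_bigr => J _; rewrite -(big_mkcond (fun i => i \in J)).
rewrite [in RHS]big_split /= prodr_const.
rewrite -rmorph_prod -rmorphXn /= coefCM coef_map coefMC coefXn eq_sym.
by case: eqP => _; rewrite ?mul1r ?mul0r.
Qed.

(** * The triple product modulo a power of [q] *)

Lemma rmorph_qpoch (R S : comNzRingType) (f : {rmorphism R -> S}) q n :
  f (qpoch q n) = qpoch (f q) n.
Proof.
by rewrite rmorph_prod; apply: eq_bigr => i _; rewrite rmorphB rmorph1 rmorphXn.
Qed.

Lemma coef0_qpoch (R : comNzRingType) n : (qpoch ('X : {poly R}) n)`_0 = 1.
Proof.
elim: n => [|n IH]; first by rewrite /qpoch big_ord0 coef1.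
by rewrite qpochS coef0M IH coefB coef1 coefXn subr0 mulr1.
Qed.

Lemma qpoch_tail (R : comNzRingType) m n : (n <= m)%N ->
  exists2 u, qpoch ('X : {poly R}) m = qpoch 'X n * u & eqX n.+1 u 1.
Proof.
move=> /subnK <-; elim: (m - n)%N => [|d [u eu u1]].
  by exists 1; rewrite ?mulr1.
exists (u * (1 - 'X ^+ (d + n).+1)); first by rewrite addSn qpochS eu mulrA.
rewrite -[1 in X in eqX _ _ X]mulr1; apply: eqXM => // i lti.
rewrite coefB coefXn (_ : (i == _) = false) ?subr0 //.
by apply/negbTE; rewrite neq_ltn ltnS (leq_trans _ (leq_addl d n)).
Qed.

(** By [theta_coefE] the left side is ['X^('C(k.+1, 2))] times two tails of [qpoch]. These are 1
    only modulo ['X^(M - k + 1)]; the missing [k] degrees come from [k <= 'C(k.+1, 2)]. *)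
Lemma theta_coef_limit (R : idomainType) M k : (k <= M)%N ->
  eqX M.+1 (qpoch 'X M * theta_coef ('X : {poly R}) M k) 'X^('C(k.+1, 2)).
Proof.
move=> lekM; have [u eu u1] := qpoch_tail R (leq_subr k M).
have [|w ew w1] := @qpoch_tail R (2 * M).+1 (M + k).+1; first by lia.
have nz : qpoch ('X : {poly R}) (M + k).+1 != 0.
  by apply: contra_eq_neq (coef0_qpoch R (M + k).+1) => ->;
    rewrite coef0 eq_sym oner_neq0.
have -> : qpoch 'X M * theta_coef 'X M k
    = 'X^('C(k.+1, 2)) * (u * w) :> {poly R}.
  apply: (mulfI nz); rewrite eu.
  transitivity (u * (qpoch ('X : {poly R}) (M - k) * qpoch 'X (M + k).+1
                     * theta_coef 'X M k)).
    by ring.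
  by rewrite theta_coefE // ew; ring.
have uw1 : eqX (M - k).+1 (u * w) 1.
  by rewrite -[1]mulr1; apply: eqXM => //; apply: eqXW w1; lia.
have le_bin : (k <= 'C(k.+1, 2))%N by rewrite binS bin1 leq_addl.
move=> i lti; rewrite coefXnM coefXn.
case: ltngtP => // [lti'|->]; last by rewrite subnn uw1 // coef1.
by rewrite uw1 ?coef1; [case: eqP => //; lia | lia].
Qed.

Lemma MO_generating_poly_theta n :
  eqX n.+1
    (\prod_(i < n) (1 + 'X%:P * map_poly polyC (MO_factor 1 n i.+1))
       * map_poly polyC (qpoch ('X : {poly int}) n \Po 'X^3))
    (\sum_(k < n.+1) 'X^('C(k.+1, 2)) * (theta_poly k)%:P).
Proof.
set P := \prod_(i < n) _.
(* Factorwise, [1 - q^(3m) = (1 + q^m + q^(2m)) (1 - q^m)]. *)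
have -> : map_poly polyC (qpoch ('X : {poly int}) n \Po 'X^3) =
    (\prod_(i < n) map_poly polyC (1 + 1%:P * 'X^(i.+1) + 'X^(2 * i.+1)))
      * qpoch ('X : {poly {poly int}}) n.
  rewrite rmorph_qpoch /= comp_polyX rmorph_qpoch /= map_polyXn.
  rewrite /qpoch -big_split /=; apply: eq_bigr => i _.
  rewrite !rmorphD rmorphM !rmorph1 /= !map_polyXn mul2n -addnn exprD -exprM.
  by rewrite (_ : 3 * i.+1 = i.+1 + i.+1 + i.+1)%N ?exprD; [ring | lia].
rewrite mulrA -big_split /=.
pose T : {poly {poly int}} :=
  \prod_(i < n) (1 + (1 + 'X)%:P * 'X^(i.+1) + 'X^(2 * i.+1)).
apply: (@eqX_trans _ _ (T * qpoch 'X n)).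
  apply: eqXM => //; apply: eqX_prod => i _.
  have /(eqX_map polyC) := @trunc_inv_MO_den n.+1 1 i.+1 isT.
  rewrite /MO_factor !rmorph1 !rmorphM /=; set D := map_poly _ (_ + _).
  set V := map_poly _ (trunc _ _) => DV.
  (* The numerator is [D + x q^m]; replacing the trailing [1] by [D * V], congruent to it, makes [D]
     a common factor. *)
  have -> : 1 + (1 + 'X)%:P * 'X^(i.+1) + 'X^(2 * i.+1)
      = D + 'X%:P * 'X^(i.+1) * 1.
    by rewrite /D !rmorphD !rmorphM !rmorph1 /= !map_polyXn; ring.
  rewrite map_polyXn (_ : _ * D = D + 'X%:P * 'X^(i.+1) * (D * V));
    last by ring.
  by apply: eqXD => //; apply: eqXM.
rewrite /T (@finite_triple_product _ _ _ (fun k => (theta_poly k)%:P)) //;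
  last first.
- by move=> k; rewrite theta_polySS rmorphB rmorphM.
- by rewrite rmorphD rmorph1 /=; ring.
rewrite mulrC mulr_sumr; apply: eqX_sum => k _; rewrite mulrA.
by apply: eqXM => //; apply: theta_coef_limit; rewrite -ltnS.
Qed.

(** * Divisibility by 9 *)

Lemma dvd9_theta_sum n J j :
  (9 %| (\sum_(k < n) 'X^('C(k.+1, 2)) * (theta_poly k)%:P)
          `_(3 * j + 1)`_(3 * J + 2))%Z.
Proof.
rewrite !coef_sum; apply: rpred_sum => k _.
rewrite coefMC coefXn; case: eqP => [ek|_]; last by rewrite mul0r coef0 dvdz0.
(* [k (k + 1) = 2 (3j + 1)] is not divisible by 3, which leaves only residue 1 for [k]. *)
have [m ->] : exists m, k = (3 * m).+1 :> nat.
  exists (k %/ 3)%N.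
  have := mul_bin_diag k.+1 1; rewrite bin1 -ek /= => e.
  have := divn_eq k 3; have := ltn_pmod k (isT : 0 < 3)%N.
  move: (k %/ 3)%N (k %% 3)%N => m [|[|[|//]]] _ ek3; rewrite ek3 in e *; lia.
by rewrite mul1r theta_poly_triple addn2 coefXM /= dvd9_coef_comp_cubic.
Qed.

Theorem theorem3p2 (J N : nat) :
  (MO 1 (3 * J + 2)%N (3 * N + 1)%N = 0 %[mod 9])%Z.
Proof.
rewrite mod0z; apply/dvdz_mod0P; rewrite MO_generating_poly.
set n := (3 * N + 1)%N; set P := \prod_(i < n) _.
(* Up to degree [n], the theta sum is [P] times a polynomial in [q^3] with constant term 1. Its
   coefficient at [3j + 1] is therefore that of [P] plus multiples of those of [P] at smaller
   exponents congruent to 1 mod 3, and strong induction applies. *)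
suff dvdP j : (3 * j + 1 <= n)%N -> (9 %| P`_(3 * j + 1)`_(3 * J + 2))%Z.
  exact: dvdP.
elim/ltn_ind: j => j IH le_jn.
have := dvd9_theta_sum n.+1 J j.
rewrite -(MO_generating_poly_theta le_jn) -/P coefM big_ord_recr /= subnn.
rewrite coefD coef_sum coef_map coefMC coef_comp_poly_Xn // dvdn0 div0n.
rewrite coef0_qpoch mulr1.
rewrite rpredDl //; apply: rpred_sum => -[i /= lti] _.
rewrite coef_map coefMC coef_comp_poly_Xn //.
case: ifP => [/dvdnP[l el]|_]; last by rewrite mulr0 dvdz0.
have -> : i = (3 * (j - l) + 1)%N by lia.
by rewrite dvdz_mulr // IH //; lia.
Qed.
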